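(* Let $T$ be a tree and $d$ its diameter, then $\mathrm{thin}(T) \leq \lceil\frac{d+1}{4}\rceil$. Moreover, if the maximum degree of a vertex in $T$ is at most $3$, then $\mathrm{thin}(T) \leq \lceil\frac{d+3}{6}\rceil$.
   Context: A graph $G$ is $k$-thin if there exist a strict total order $\prec$ on $V(G)$ and a partition of $V(G)$ into $k$ classes such that for all $u \prec v \prec w$ with $u,v$ in the same class and $(u,w)\in E(G)$, also $(v,w)\in E(G)$; the thinness $\mathrm{thin}(G)$ is the minimum such $k$. The diameter of a tree is the maximum number of edges in a simple path joining two vertices. *)

(* Defs.v *)
From HB Require Import structures.
From mathcomp Require Import all_boot all_order all_algebra.

Set Implicit Arguments.
Unset Strict Implicit.
Unset Printing Implicit Defensive.

Record sgraph := SGraph {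
  vertex :> finType;
  edge : rel vertex;
  edge_sym : symmetric edge;
  edge_irrefl : irreflexive edge }.

Arguments edge {G} : rename.

Definition degree (G : sgraph) (x : G) : nat := #|[set y | edge x y]|.

Definition max_degree (G : sgraph) : nat := \max_(x : G) degree x.

Definition connected (G : sgraph) : Prop := forall x y : G, connect edge x y.

(* [ucycle] also holds of the sequences [:: x; y] with [x] and [y] adjacent,
   which traverse one edge back and forth; only length at least 3 is a cycle. *)
Definition acyclic (G : sgraph) : Prop :=
  forall c : seq G, ucycle edge c -> size c <= 2.

Definition is_tree (G : sgraph) : Prop :=
  [/\ 0 < #|G|, connected G & acyclic G].

Definition simple_path (G : sgraph) (x : G) (p : seq G) : bool :=
  path edge x p && uniq (x :: p).

(* [x :: p] has [size p] edges, and a simple path has fewer than [#|G|] edges,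
   so the bound on [n] excludes nothing. *)
Definition diameter (G : sgraph) : nat :=
  \max_(n < #|G| | [exists x : G, exists p : n.-tuple G, simple_path x p]) n.

Definition strict_total_order (T : Type) (lt : rel T) : Prop :=
  [/\ irreflexive lt, transitive lt & forall x y, x <> y -> lt x y \/ lt y x].

Definition consistent (G : sgraph) (lt : rel G) (P : {set {set G}}) : Prop :=
  forall (A : {set G}) (u v w : G), A \in P -> u \in A -> v \in A ->
    lt u v -> lt v w -> edge u w -> edge v w.

Definition k_thin (G : sgraph) (k : nat) : Prop :=
  exists (lt : rel G) (P : {set {set G}}),
    [/\ strict_total_order lt, partition P [set: G], #|P| = k
      & consistent lt P].

(* Boolean counterpart of [k_thin], with the order given by its graph
   [R : {set G * G}], used to take the minimum with [ex_minn]. *)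
Definition k_thinb (G : sgraph) (k : nat) : bool :=
  [exists R : {set G * G}, exists P : {set {set G}},
    [&& [forall x, (x, x) \notin R],
        [forall x, forall y, forall z,
           ((x, y) \in R) && ((y, z) \in R) ==> ((x, z) \in R)],
        [forall x, forall y, (x != y) ==> ((x, y) \in R) || ((y, x) \in R)],
        partition P [set: G], #|P| == k
      & [forall A in P, forall u in A, forall v in A, forall w,
           [&& (u, v) \in R, (v, w) \in R & edge u w] ==> edge v w]]].

Lemma k_thinP (G : sgraph) (k : nat) : reflect (k_thin G k) (k_thinb G k).
Proof.
apply: (iffP existsP) => [[R /existsP[P /and5P[irR trR toR PP /andP[/eqP cP cR]]]]|].
  exists (fun x y => (x, y) \in R), P; split=> //; first split.
  - by move=> x; apply/negbTE/(forallP irR).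
  - move=> y x z xy yz; move/forallP/(_ x)/forallP/(_ y)/forallP/(_ z): trR.
    by rewrite xy yz.
  - move=> x y /eqP nxy; move/forallP/(_ x)/forallP/(_ y): toR.
    by rewrite nxy => /orP.
  move=> A u v w AP uA vA uv vw uw.
  move/forall_inP/(_ A AP)/forall_inP/(_ u uA)/forall_inP/(_ v vA): cR.
  by move/forallP/(_ w); rewrite uv vw uw.
case=> lt [P [[irl trl tol] PP cP cR]].
exists [set xy | lt xy.1 xy.2]; apply/existsP; exists P.
apply/and5P; split=> //; last (apply/andP; split; first exact/eqP).
- by apply/forallP => x; rewrite inE /= irl.
- apply/forallP => x; apply/forallP => y; apply/forallP => z.
  by rewrite !inE /=; apply/implyP => /andP[]; apply: trl.
- apply/forallP => x; apply/forallP => y; rewrite !inE /=.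
  by apply/implyP => /eqP /tol /orP.
apply/forall_inP => A AP; apply/forall_inP => u uA; apply/forall_inP => v vA.
apply/forallP => w; rewrite !inE /=; apply/implyP => /and3P[].
exact: cR AP uA vA.
Qed.

Lemma k_thin_card (G : sgraph) : k_thin G #|G|.
Proof.
exists (fun x y => enum_rank x < enum_rank y), [set [set x] | x : G]; split.
- split; first by move=> x; rewrite ltnn.
    by move=> y x z; apply: ltn_trans.
  move=> x y nxy; apply/orP; rewrite -neq_ltn; apply/eqP => /val_inj exy.
  exact/nxy/enum_rank_inj.
- apply/and3P; split.
  + apply/eqP/setP => x; rewrite inE; apply/bigcupP; exists [set x].
      exact: imset_f.
    exact: set11.
  + apply/trivIsetP => _ _ /imsetP[x _ ->] /imsetP[y _ ->] nxy.
    by rewrite disjoints1 inE; apply: contra nxy => /eqP->.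
  + by apply/imsetP => -[x _ /setP/(_ x)]; rewrite !inE eqxx.
- by rewrite card_imset //; apply: set1_inj.
move=> _ u v w /imsetP[x _ ->] /set1P-> /set1P->; by rewrite ltnn.
Qed.

Lemma ex_k_thinb (G : sgraph) : exists k, k_thinb G k.
Proof. by exists #|G|; apply/k_thinP/k_thin_card. Qed.

Definition thinness (G : sgraph) : nat := ex_minn (ex_k_thinb G).

Lemma thinnessP (G : sgraph) :
  k_thin G (thinness G) /\ forall k, k_thin G k -> thinness G <= k.
Proof.
rewrite /thinness; case: ex_minnP => m /k_thinP mthin mmin.
by split=> // k /k_thinP; apply: mmin.
Qed.

(* Main.v *)
(* Let [P] be a path of the tree. If the components of [T \ N[P]] can be ordered
   with [k] classes, so can [T] with one class more, namely the vertices of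
   [N[P]]: go along [P]; for each [x] on [P] and each neighbour [c] of [x] off
   [P], list [c], then the components hanging below [c], and list [x] after all
   its neighbours [c].  Starting from the centre edge of a longest path, every
   branch loses two levels when [P] is its root alone.  If all degrees are at
   most 3 it loses three levels, because [P] can then run through the root and
   both of its children. *)

Require Import Defs.
From mathcomp Require Import all_boot all_order all_algebra.
From mathcomp Require Import zify.
Import Order.TTheory GRing.Theory Num.Theory.

Set Implicit Arguments.
Unset Strict Implicit.
Unset Printing Implicit Defensive.

Lemma in_pairwise (A : eqType) (r : rel A) (s : seq A) :
  {in s &, forall x y, r x y} -> pairwise r s.
Proof.
elim: s => //= x s IHs rs; apply/andP; split.
  by apply/allP => y ys; apply: rs; rewrite !inE ?eqxx ?ys ?orbT.
by apply: IHs => y z ys zs; apply: rs; rewrite inE ?ys ?zs orbT.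
Qed.

(** * Vertex orders with classes, encoded as lists *)

Section Layout.

Variable T : sgraph.
Implicit Types (u v w : T * nat) (s : seq (T * nat)) (k : nat).

(* A layout lists the vertices in the order of the k-thin representation, each
   paired with the index of its class. *)
Definition pull u v w :=
  (u.2 == v.2) ==> edge u.1 w.1 ==> edge v.1 w.1.

Fixpoint tri s :=
  if s is u :: s' then pairwise (pull u) s' && tri s' else true.

Lemma tri_cat s1 s2 :
  tri s1 -> tri s2 ->
  {in s1, forall u, pairwise (pull u) s2} ->
  {in s2, forall w, pairwise (fun u v => pull u v w) s1} ->
  tri (s1 ++ s2).
Proof.
elim: s1 => //= u s1 IHs /andP[us1 ts1] ts2 h1 h2.
rewrite pairwise_cat us1 h1 ?mem_head // !andbT; apply/andP; split.
  apply/allrelP => v w vs1 ws2.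
  by have /andP[/allP/(_ v vs1)] := h2 w ws2.
apply: IHs => // [v vs1|w ws2]; first by apply: h1; rewrite inE vs1 orbT.
by have /andP[] := h2 w ws2.
Qed.

Lemma tri_cat_nonadj s1 s2 :
  tri s1 -> tri s2 -> {in s1 & s2, forall u w, ~~ edge u.1 w.1} ->
  tri (s1 ++ s2).
Proof.
move=> t1 t2 h; apply: tri_cat => // [u us1|w ws2].
  by apply: in_pairwise => v w _ ws2; rewrite /pull (negbTE (h _ _ us1 ws2)) implybT.
by apply: in_pairwise => u v us1 _; rewrite /pull (negbTE (h _ _ us1 ws2)) implybT.
Qed.

Lemma tri_nth z0 s i j l :
  tri s -> i < j -> j < l -> l < size s ->
  pull (nth z0 s i) (nth z0 s j) (nth z0 s l).
Proof.
elim: s i j l => // u s IHs [|i] [|j] [|l] //= /andP[us ts] ij jl ls; last exact: IHs.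
by move/(pairwiseP z0): us; apply=> //; rewrite inE; lia.
Qed.

Definition layout k s :=
  [/\ uniq (unzip1 s), all (fun z => z.2 < k) s & tri s].

Definition far u w := (u.1 != w.1) && ~~ edge u.1 w.1.

(** Blocks are contiguous and no edge joins two of them, so an edge and all vertices listed between
    its ends lie in one block. Hence all blocks can reuse the same [k] classes. *)
Lemma layout_flatten (I : eqType) k (B : I -> seq (T * nat)) (r : seq I) :
  uniq r -> {in r, forall i, layout k (B i)} ->
  {in r &, forall i j, i != j -> {in B i & B j, forall u w, far u w}} ->
  layout k (flatten [seq B i | i <- r]).
Proof.
elim: r => //= i r IHr /andP[ir ur] lB farB.
have [||u1 c1 t1] := IHr ur.
- by move=> j jr; apply: lB; rewrite inE jr orbT.
- by move=> j l jr lr; apply: farB; rewrite inE ?jr ?lr orbT.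
have [u2 c2 t2] := lB i (mem_head _ _).
have farr : {in B i & flatten [seq B i | i <- r], forall u w, far u w}.
  move=> u w uB /flatten_mapP[j jr wB]; apply: (farB i j) => //.
  - exact: mem_head.
  - by rewrite inE jr orbT.
  - by apply: contraNneq ir => ->.
split.
- rewrite /unzip1 map_cat cat_uniq -/unzip1 u1 u2 andbT /=; apply/hasPn => y.
  case/mapP=> w wr ->; apply/mapP => -[u uB e].
  by have /andP[] := farr u w uB wr; rewrite e eqxx.
- by rewrite all_cat c1 c2.
- by apply: tri_cat_nonadj => // u w uB wr; have /andP[] := farr u w uB wr.
Qed.

(** [x] comes first, so it can only be the [u] of a triple, and it has no companion in the new class
    [k]. *)
Lemma layout_cons k x s :
  x \notin unzip1 s -> layout k s -> layout k.+1 ((x, k) :: s).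
Proof.
move=> xs [us cs ts]; split=> /=; first by rewrite xs.
  by rewrite ltnS leqnn; apply: sub_all cs => z /ltnW.
rewrite ts andbT; apply: in_pairwise => v w vs _; rewrite /pull /=.
by move/allP/(_ v vs): cs; rewrite ltn_neqAle eq_sym => /andP[/negbTE->].
Qed.

(** [x] comes last, so it can only be the [w] of a triple. Two earlier vertices of one class are
    both in class [k] or both outside it, hence both or neither adjacent to [x]. *)
Lemma layout_rcons k x s :
  x \notin unzip1 s -> layout k.+1 s ->
  {in s, forall z, (z.2 == k) = edge z.1 x} -> layout k.+1 (rcons s (x, k)).
Proof.
move=> xs [us cs ts] adj; split.
- by rewrite /unzip1 map_rcons rcons_uniq xs.
- by rewrite all_rcons /= ltnS leqnn.
- rewrite -cats1; apply: tri_cat => // w /[!inE] /eqP->.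
  apply: in_pairwise => u v us' vs'; rewrite /pull /= -!adj //.
  by apply/implyP => /eqP->; apply/implyP.
Qed.

(* The path [.. y, x ..] of the layout lemma: [y] closes the earlier part,
   [x] the later one, and [yx] is the only edge between the two. *)
Lemma layout_glue k y x s1 s2 :
  layout k.+1 (rcons s1 (y, k)) -> layout k.+1 (rcons s2 (x, k)) ->
  {in s2, forall z, (z.2 == k) = edge z.1 x} ->
  {in unzip1 (rcons s1 (y, k)) & unzip1 (rcons s2 (x, k)),
     forall a b, a != b /\ (edge a b -> a = y /\ b = x)} ->
  layout k.+1 (rcons s1 (y, k) ++ rcons s2 (x, k)).
Proof.
move=> [u1 c1 t1] [u2 c2 t2] adj cross; split.
- rewrite /unzip1 map_cat cat_uniq -/unzip1 u1 u2 andbT /=; apply/hasPn => b bs.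
  by apply/negP => /cross/(_ bs)[/eqP].
- by rewrite all_cat c1.
have crossE u w : u \in rcons s1 (y, k) -> w \in rcons s2 (x, k) ->
    edge u.1 w.1 -> u.1 = y /\ w.1 = x.
  by move=> us ws e; have [_ /(_ e)] := cross u.1 w.1 (map_f _ us) (map_f _ ws).
have ny z : z \in s1 -> z.1 != y.
  move=> zs; move: u1; rewrite /unzip1 map_rcons rcons_uniq => /andP[/= + _].
  by apply: contraNneq => <-; apply: map_f.
have nx z : z \in s2 -> z.1 != x.
  move=> zs; move: u2; rewrite /unzip1 map_rcons rcons_uniq => /andP[/= + _].
  by apply: contraNneq => <-; apply: map_f.
apply: tri_cat => // [u us|w ws].
- rewrite pairwise_rcons; apply/andP; split; last first.
    apply: in_pairwise => v w _ ws; apply/implyP => _; apply/implyP.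
    move/(crossE _ _ us) => [|_ /eqP]; first by rewrite mem_rcons inE ws orbT.
    by rewrite (negbTE (nx _ ws)).
  (* The edge can only be [yx], so [v] has the class [k] of [y] and is adjacent to [x] by [adj]. *)
  apply/allP => v vs; apply/implyP => /eqP cuv; apply/implyP => /=.
  move=> /(crossE _ (x, k) us)[|uy _]; first by rewrite mem_rcons mem_head.
  move: us; rewrite mem_rcons inE => /orP[/eqP eu|/ny]; last by rewrite uy eqxx.
  by rewrite -adj // -cuv eu.
(* Here [u] precedes another vertex of the earlier part, so it is not [y] and has no edge to the
   later part. *)
- rewrite pairwise_rcons; apply/andP; split.
    apply/allP => u us; apply/implyP => _; apply/implyP.
    move=> /(crossE _ _ _ ws)[|/eqP]; first by rewrite mem_rcons inE us orbT.
    by rewrite (negbTE (ny _ us)).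
  apply: in_pairwise => u v us _; apply/implyP => _; apply/implyP.
  move=> /(crossE _ _ _ ws)[|/eqP]; first by rewrite mem_rcons inE us orbT.
  by rewrite (negbTE (ny _ us)).
Qed.

Lemma thinness_layout k s :
  (forall x : T, x \in unzip1 s) -> layout k s -> thinness T <= k.
Proof.
move=> cov [us cs ts]; have [_ thin_min] := thinnessP T.
pose idx (x : T) := index x (unzip1 s).
have idx_lt x : idx x < size s by rewrite /idx -(size_map fst s) index_mem.
(* The default [(x, 0)] is never returned, because [idx x < size s]. *)
pose col (x : T) := (nth (x, 0) s (idx x)).2.
have nthE z0 x : nth z0 s (idx x) = (x, col x).
  rewrite (set_nth_default (x, 0)) // [LHS]surjective_pairing; congr pair.
  by rewrite -(nth_map _ x) // nth_index.
have col_lt x : col x < k by move/allP: cs; apply; apply: mem_nth.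
pose P := preim_partition col [set: T].
(* Only indices that occur give a member of [P], so [P] may have fewer than [k] classes. *)
suff /thin_min/leq_trans : k_thin T #|P|.
  apply; apply: leq_trans (_ : #|[set [set y | col y == i :> nat] | i : 'I_k]| <= k).
    apply/subset_leq_card/subsetP => A /imsetP[x _ ->].
    apply/imsetP; exists (Ordinal (col_lt x)) => //.
    by apply/setP => y; rewrite !inE /= eq_sym.
  by rewrite (leq_trans (leq_imset_card _ _)) // card_ord.
exists (fun x y => idx x < idx y), P; split=> //.
- split=> [x|y x z|x y nxy]; first by rewrite ltnn.
    exact: ltn_trans.
  apply/orP; rewrite -neq_ltn; apply/eqP => e; apply: nxy.
  by have := nthE (x, 0) x; rewrite e nthE => -[].
- exact: preim_partitionP.
move=> A u v w /imsetP[x _ ->]; rewrite !inE /= => /eqP xu /eqP xv uv vw.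
have := tri_nth (u, 0) ts uv vw (idx_lt w).
by rewrite !nthE /pull /= -xu -xv eqxx /= => /implyP.
Qed.

End Layout.

(** * Branches cut off by an edge of an acyclic graph *)

Section Tree.

Variable T : sgraph.
Hypothesis acT : acyclic T.
Implicit Types (a b c g p v x y : T) (q ex : seq T) (k h : nat).

Lemma closed_path_short v q :
  path edge v q -> uniq (v :: q) -> edge (last v q) v -> size q <= 1.
Proof.
by move=> vq uq qv; apply: (acT (c := v :: q)); rewrite /ucycle uq /= rcons_path vq qv.
Qed.

Lemma edge_neq x y : edge x y -> x != y.
Proof. by apply: contraTneq => ->; rewrite edge_irrefl. Qed.

(* The component of [v] after deletion of the edge [pv]. *)
Definition branch p v x : Prop :=
  exists q, [/\ path edge v q, uniq [:: p, v & q] & last v q = x].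

Lemma branch_root p v : edge p v -> branch p v v.
Proof. by move=> /edge_neq pv; exists [::]; rewrite /= inE pv. Qed.

Lemma mem_branch p v q x :
  path edge v q -> uniq [:: p, v & q] -> x \in v :: q -> branch p v x.
Proof.
move=> + + xq; case/splitPl: xq => q1 q2 e vq uq; exists q1; split=> //.
  by move: vq; rewrite cat_path => /andP[].
have : uniq ([:: p, v & q1] ++ q2) by [].
by rewrite cat_uniq => /andP[].
Qed.

Lemma branchN p v : ~ branch p v p.
Proof.
case=> q [_ /andP[pq _] e]; move: pq.
by rewrite -e mem_last.
Qed.

(** An edge from [x] to [p] other than [vp] would close a cycle with the path from [v] to [x]. *)
Lemma branch_out p v x y : edge p v -> branch p v x -> edge x y ->
  branch p v y \/ x = v /\ y = p.
Proof.
move=> pv [q [vq /= /andP[pq uq] ex]] xy.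
have [yq|nyq] := boolP (y \in v :: q).
  by left; apply: mem_branch yq => //; rewrite cons_uniq pq.
have [eyp|nyp] := eqVneq y p.
  right; split=> //; rewrite eyp in xy.
  have := @closed_path_short p (v :: q); rewrite /= pv pq uq ex xy vq.
  by move=> /(_ isT isT isT); rewrite -ex; case: (q).
left; exists (rcons q y); rewrite last_rcons rcons_path vq ex xy; split=> //.
by rewrite -!rcons_cons rcons_uniq inE negb_or nyp nyq /= pq.
Qed.

(** If the path from [c] met [p], its part up to [p] would close through [v] to a cycle of length at
    least 3. *)
Lemma uniq_prepend p v c q : edge p v -> edge v c -> c != p ->
  path edge c q -> uniq [:: v, c & q] -> uniq [:: p, v, c & q].
Proof.
move=> pv vc cp cq uq; rewrite cons_uniq uq andbT !inE !negb_or eq_sym.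
rewrite eq_sym (edge_neq pv) (eq_sym p) cp /=; apply/negP => pq.
case/splitPr: pq cq uq => q1 q2 cq uq.
suff: size (c :: rcons q1 p) <= 1 by rewrite /= size_rcons.
apply: (@closed_path_short v); last by rewrite /= last_rcons.
- by move: cq; rewrite /= vc -cat_rcons cat_path => /andP[].
- by move: uq; rewrite -cat_rcons -!cat_cons cat_uniq => /andP[].
Qed.

Lemma branch_kid p v c x :
  edge p v -> edge v c -> c != p -> branch v c x -> branch p v x.
Proof.
move=> pv vc cp [q [cq uq ex]]; exists (c :: q); rewrite /= vc cq; split=> //.
exact: uniq_prepend.
Qed.

Lemma branchP p v x : edge p v ->
  branch p v x <-> x = v \/ exists c, [/\ edge v c, c != p & branch v c x].
Proof.
move=> pv; split=> [[[|c q] []]|[->|[c [vc cp]]]].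
- by left.
- move=> /= /andP[vc cq] /andP[pq uq] ex; right; exists c; split=> //.
    by move: pq; rewrite !inE !negb_or eq_sym => /and3P[_ + _]; rewrite eq_sym.
  by exists q; split.
- exact: branch_root.
- exact: branch_kid.
Qed.

(** The branch can be entered only through the edge [pv], which a path missing one of its ends does
    not cross. *)
Lemma branch_backward p v z q : edge p v -> path edge z q ->
  (p \notin z :: q) || (v \notin z :: q) -> branch p v (last z q) -> branch p v z.
Proof.
move=> pv; elim: q z => //= z1 q IHq z /andP[zz1 z1q] avoid /IHq-/(_ z1q) bz1.
have {}bz1 : branch p v z1.
  apply: bz1; move: avoid; rewrite !(in_cons z) !negb_or.
  by case/orP=> /andP[_ ->]; rewrite ?orbT.
rewrite edge_sym in zz1.
have [//|[ev ep]] := branch_out pv bz1 zz1.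
by move: avoid; rewrite ev ep !inE !eqxx orbT.
Qed.

(** The path from [c] to a common vertex avoids [x], which puts [c] into the branch of [c']. The
    path from [c'] to [c] then closes a cycle through [x]. *)
Lemma branch_disjoint x c c' y : edge x c -> edge x c' -> c != c' ->
  branch x c y -> ~ branch x c' y.
Proof.
move=> xc xc' cc' [q [cq uq <-]] b'.
have [q' [cq' uq' e]] : branch x c' c.
  by apply: branch_backward cq _ b' => //; have /andP[-> _] := uq.
have := @closed_path_short x (c' :: q'); rewrite /= xc' cq' e edge_sym xc.
move/(_ isT uq' isT); case: q' e {cq' uq'} => //= ecc'.
by rewrite ecc' eqxx in cc'.
Qed.

Lemma branch_disjoint_edge a b y :
  edge a b -> branch a b y -> ~ branch b a y.
Proof.
move=> ab [q [bq uq <-]] ba; apply: (@branchN b a).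
apply: branch_backward bq _ ba; first by rewrite edge_sym.
by have /andP[-> _] := uq; rewrite orbT.
Qed.

(** A walk from [a] to [y] changes sides only by crossing the edge [ab]. *)
Lemma branch_cover a b y : connected T -> edge a b ->
  branch a b y \/ branch b a y.
Proof.
move=> conT ab; have /connectP[q aq ->] := conT a y.
have ba : edge b a by rewrite edge_sym.
elim/last_ind: q aq => [_|q z IHq]; first by right; apply: branch_root.
rewrite rcons_path last_rcons => /andP[/IHq + qz].
case=> [/(branch_out ab)/(_ qz)[|[_ ->]]|/(branch_out ba)/(_ qz)[|[_ ->]]]; auto.
  by right; apply: branch_root.
by left; apply: branch_root.
Qed.

Lemma branch_far x c c' u w : edge x c -> edge x c' -> c != c' ->
  branch x c u -> branch x c' w -> u != w /\ ~~ edge u w.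
Proof.
move=> xc xc' cc' bu bw; have ndisj := branch_disjoint xc xc' cc'.
split; first by apply/eqP => euw; apply: (ndisj w) => //; rewrite -euw.
apply/negP => uw; have [/ndisj//|[_ ewx]] := branch_out xc bu uw.
by apply: (@branchN x c'); rewrite -{2}ewx.
Qed.

(* The branch of [v] away from [p] has at most [h] levels, that is, height less
   than [h]. *)
Definition low p v h : Prop :=
  forall q, path edge v q -> uniq [:: p, v & q] -> size q < h.

Lemma low_kid p v c h : edge p v -> edge v c -> c != p ->
  low p v h.+1 -> low v c h.
Proof.
move=> pv vc cp lowp q cq uq; apply: (lowp (c :: q)); first by rewrite /= vc.
exact: uniq_prepend.
Qed.

Lemma low0 p v : edge p v -> ~ low p v 0.
Proof. by move=> /edge_neq pv /(_ [::] isT); rewrite /= inE pv => /(_ isT). Qed.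

Lemma low_leq p v h h' : h <= h' -> low p v h -> low p v h'.
Proof. by move=> hh' l q vq uq; apply: leq_trans (l q vq uq) hh'. Qed.

Definition spans p v (s : seq (T * nat)) : Prop :=
  forall x, x \in unzip1 s <-> branch p v x.

Definition nbrs ex x := [seq c <- enum T | edge x c & c \notin ex].

Lemma mem_nbrs ex x c : (c \in nbrs ex x) = edge x c && (c \notin ex).
Proof. by rewrite mem_filter mem_enum andbT. Qed.

(** * The layout around one vertex of the path *)

Section Fan.

(** [F c g] stands for a layout, with [k] classes, of the branch of [g] away from [c]; the index [k]
    is the additional class. *)
Variables (k : nat) (F : T -> T -> seq (T * nat)).

Definition twig x c := (c, k) :: flatten [seq F c g | g <- nbrs [:: x] c].

Definition stem ex x := flatten [seq twig x c | c <- nbrs ex x].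

(* The part of the layout contributed by a vertex [x] of the path, whose
   neighbours on the path form [ex]. *)
Definition fan ex x := rcons (stem ex x) (x, k).

Lemma spans_twig x c : edge x c ->
  (forall g, edge c g -> g != x -> spans c g (F c g)) ->
  spans x c (twig x c).
Proof.
move=> xc spF y; rewrite inE (branchP _ xc); split.
  case/predU1P=> [|/mapP[z /flatten_mapP[g]]]; first by left.
  rewrite mem_nbrs inE => /andP[cg gx] zF ->; right; exists g; split=> //.
  by apply/spF => //; apply: map_f.
case=> [->|[g [cg gx /(spF g cg gx)/mapP[z zF ->]]]]; first by rewrite eqxx.
rewrite map_f ?orbT //; apply/flatten_mapP.
by exists g => //; rewrite mem_nbrs inE cg.
Qed.

(** [c] is both the only neighbour of [x] in its branch and the only vertex of class [k] there;
    [layout_rcons] needs this agreement when [x] is appended. *)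
Lemma twigP x c : edge x c ->
  (forall g, edge c g -> g != x -> layout k (F c g) /\ spans c g (F c g)) ->
  [/\ layout k.+1 (twig x c), spans x c (twig x c)
    & {in twig x c, forall z, (z.2 == k) = edge z.1 x}].
Proof.
move=> xc okF.
have sp : spans x c (twig x c).
  by apply: (spans_twig xc) => // g cg gx; have [] := okF g cg gx.
have Fg g : g \in nbrs [:: x] c -> [/\ edge c g, g != x, layout k (F c g)
    & forall z, z \in F c g -> branch c g z.1].
  rewrite mem_nbrs inE => /andP[cg gx]; have [lF sF] := okF g cg gx.
  by split=> // z zF; apply/sF/map_f.
have NcF z : z \in flatten [seq F c g | g <- nbrs [:: x] c] -> z.1 != c /\ z.2 < k.
  case/flatten_mapP=> g /Fg[cg gx [_ /allP cF _] bF] zF.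
  split; last exact: cF.
  by apply/eqP => ezc; apply: (@branchN c g); rewrite -{2}ezc; apply: bF.
split=> //.
  apply: layout_cons; first by apply/mapP => -[z /NcF[+ _] ecz]; rewrite ecz eqxx.
  apply: layout_flatten; first by rewrite filter_uniq ?enum_uniq.
    by move=> g /Fg[].
  move=> g g' /Fg[cg _ _ bg] /Fg[cg' _ _ bg'] gg' u w /bg bu /bg' bw.
  exact/andP/(branch_far cg cg' gg').
move=> z zt; have bz : branch x c z.1 by apply/sp/map_f.
move: zt; rewrite inE => /predU1P[->|/NcF[zc zk]]; first by rewrite eqxx edge_sym xc.
rewrite ltn_eqF //; apply/esym/negbTE/negP => zx.
have [/branchN//|[ezc _]] := branch_out xc bz zx.
by rewrite ezc eqxx in zc.
Qed.

(** Twigs at different neighbours of [x] are far from each other, so they share their classes. The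
    adjacency clause is kept for [layout_glue]. *)
Lemma fanP ex x :
  (forall c g, edge x c -> c \notin ex -> edge c g -> g != x ->
     layout k (F c g) /\ spans c g (F c g)) ->
  [/\ layout k.+1 (fan ex x),
      {in stem ex x, forall z, (z.2 == k) = edge z.1 x}
    & forall y, y \in unzip1 (fan ex x) <->
        y = x \/ exists c, [/\ edge x c, c \notin ex & branch x c y]].
Proof.
move=> okF.
have okt c : c \in nbrs ex x -> [/\ edge x c, c \notin ex,
    layout k.+1 (twig x c), spans x c (twig x c)
  & {in twig x c, forall z, (z.2 == k) = edge z.1 x}].
  rewrite mem_nbrs => /andP[xc cex].
  by have [] := twigP xc (fun g => okF c g xc cex).
have adj : {in stem ex x, forall z, (z.2 == k) = edge z.1 x}.
  by move=> z /flatten_mapP[c /okt[_ _ _ _ ht]]; apply: ht.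
have memE y : y \in unzip1 (stem ex x) <->
    exists c, [/\ edge x c, c \notin ex & branch x c y].
  split=> [/mapP[z /flatten_mapP[c cN zt] ->]|[c [xc cex bc]]].
    have [xc cex _ sp _] := okt c cN; exists c; split=> //.
    exact/sp/map_f.
  have cN : c \in nbrs ex x by rewrite mem_nbrs xc.
  have [_ _ _ sp _] := okt c cN.
  have /mapP[z zt ->] : y \in unzip1 (twig x c) by apply/sp.
  by apply: map_f; apply/flatten_mapP; exists c.
split=> //; last first.
  move=> y; rewrite /unzip1 map_rcons mem_rcons inE -/unzip1 -memE.
  by split=> [/predU1P|[->|->]]; rewrite ?eqxx ?orbT.
apply: layout_rcons => //; first by apply/negP => /memE[c [_ _ /branchN]].
apply: layout_flatten; first by rewrite filter_uniq ?enum_uniq.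
  by move=> c /okt[].
move=> c c' /okt[xc _ _ sp _] /okt[xc' _ _ sp' _] cc' u w ut wt.
by apply/andP/(branch_far xc xc' cc'); [apply/sp/map_f|apply/sp'/map_f].
Qed.

Lemma fan_branch p x : edge p x ->
  (forall c g, edge x c -> c != p -> edge c g -> g != x ->
     layout k (F c g) /\ spans c g (F c g)) ->
  [/\ layout k.+1 (fan [:: p] x),
      {in stem [:: p] x, forall z, (z.2 == k) = edge z.1 x}
    & spans p x (fan [:: p] x)].
Proof.
move=> px okF; have [|l adj sp] := @fanP [:: p] x.
  by move=> c g xc; rewrite inE; apply: okF.
split=> // y; rewrite sp (branchP y px).
by split=> -[->|[c [xc cp bc]]]; [left|right; exists c; rewrite inE in cp|left|right; exists c; rewrite inE].
Qed.

End Fan.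

(** The path is the single edge [ab]: one fan on each side, glued along it. Each fan uses up two
    levels, so [F] has to handle branches of at most [h] levels. *)
Lemma thinness_double_fan k h F a b :
  connected T -> edge a b -> low a b h.+2 -> low b a h.+2 ->
  (forall p v, edge p v -> low p v h -> layout k (F p v) /\ spans p v (F p v)) ->
  thinness T <= k.+1.
Proof.
move=> conT ab lab lba okF; have ba : edge b a by rewrite edge_sym.
have okE p v : edge p v -> low p v h.+2 ->
    [/\ layout k.+1 (fan k F [:: p] v),
        {in stem k F [:: p] v, forall z, (z.2 == k) = edge z.1 v}
      & spans p v (fan k F [:: p] v)].
  move=> pv lowp; apply: fan_branch => // c g vc cp cg gv; apply: okF => //.
  by apply: (low_kid vc) => //; apply: low_kid lowp.
have [l1 _ s1] := okE _ _ ba lba; have [l2 adj s2] := okE _ _ ab lab.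
apply: (@thinness_layout _ _ (fan k F [:: b] a ++ fan k F [:: a] b)).
  move=> y; rewrite /unzip1 map_cat mem_cat.
  by have [/s2->|/s1->] := branch_cover y conT ab; rewrite ?orbT.
apply: layout_glue => // x y /s1 bx /s2 bY; split.
  by apply/eqP => exy; apply: branch_disjoint_edge bY _; rewrite // -exy.
move=> xy; have [bY'|[-> ->] //] := branch_out ba bx xy.
by have := branch_disjoint_edge ab bY bY'.
Qed.

(** * Recursive layouts of branches of bounded height *)

Fixpoint wide_order k p v : seq (T * nat) :=
  if k is k'.+1 then fan k' (wide_order k') [:: p] v else [::].

(** One class serves [v] and its children, and the recursion resumes at the grandchildren, two
    levels lower. *)
Lemma wide_orderP k p v : edge p v -> low p v k.*2 ->
  layout k (wide_order k p v) /\ spans p v (wide_order k p v).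
Proof.
elim: k p v => [|k IHk] p v pv lowp; first by have := low0 pv lowp.
have [|l _ sp] := @fan_branch k (wide_order k) p v pv; last by [].
move=> c g vc cp cg gv; apply: IHk => //.
by apply: (low_kid vc) => //; apply: low_kid lowp.
Qed.

(* At most two children are considered, as the degree is at most 3. *)
Fixpoint narrow_order k p v : seq (T * nat) :=
  if k is k'.+1 then
    let side r := fan k' (narrow_order k') [:: v] r in
    match nbrs [:: p] v with
    | [::] => [:: (v, k')]
    | r1 :: rs => side r1 ++ (v, k') :: (if rs is r2 :: _ then side r2 else [::])
    end
  else [::].

(** All neighbours of [v] except [p] are on the path, so one class serves [v], its children and its
    grandchildren, and the recursion resumes three levels lower. *)
Lemma narrow_orderP k p v : max_degree T <= 3 -> edge p v -> low p v (3 * k) ->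
  layout k (narrow_order k p v) /\ spans p v (narrow_order k p v).
Proof.
move=> deg3; elim: k p v => [|k IHk] p v pv lowp; first by have := low0 pv lowp.
have okside r : edge v r -> r != p ->
    [/\ layout k.+1 (fan k (narrow_order k) [:: v] r),
        {in stem k (narrow_order k) [:: v] r, forall z, (z.2 == k) = edge z.1 r}
      & spans v r (fan k (narrow_order k) [:: v] r)].
  move=> vr rp; apply: fan_branch => // c g rc cv cg gr; apply: IHk => //.
  apply: (low_kid rc) => //; apply: (low_kid vr) => //.
  by apply: (low_kid pv) => //; apply: low_leq lowp; lia.
have lv : layout k.+1 [:: (v, k)] by split; rewrite //= ltnS leqnn.
have memN c : (c \in nbrs [:: p] v) = edge v c && (c != p).
  by rewrite mem_nbrs inE.
have uN : uniq (nbrs [:: p] v) by rewrite filter_uniq ?enum_uniq.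
have sN : size (nbrs [:: p] v) <= 2.
  have : degree v <= 3 by apply: leq_trans (leq_bigmax v) deg3.
  rewrite /degree (cardD1 p) inE edge_sym pv add1n ltnS; apply: leq_trans.
  rewrite -(card_uniqP uN); apply/subset_leq_card/subsetP => c.
  by rewrite memN !inE andbC.
rewrite /=; case: (nbrs _ _) memN uN sN => [|r1 [|r2 []]] //= memN uN _.
- split=> // x; rewrite inE (branchP x pv); split=> [/eqP|]; first by left.
  case=> [->//|[c [vc cp _]]].
  by have := memN c; rewrite vc cp.
- have /andP[vr1 r1p] : edge v r1 && (r1 != p) by rewrite -memN mem_head.
  have [l1 adj1 s1] := okside _ vr1 r1p; split.
    (* The later part is [v] alone, a fan with empty stem. *)
    apply: (@layout_glue _ _ _ _ _ [::]) => // x y /s1 bx /[1!inE] /eqP /= ->.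
    split; first by apply/eqP => exv; apply: (@branchN v r1); rewrite -{2}exv.
    by case/(branch_out vr1 bx) => [/branchN|[-> _]].
  move=> x; rewrite /unzip1 map_cat mem_cat inE (branchP x pv); split.
    case/orP=> [/s1 bx|/eqP]; last by left.
    by right; exists r1.
  case=> [->|[c []]]; first by rewrite eqxx orbT.
  move=> vc cp bx; have := memN c; rewrite vc cp inE => /eqP ec.
  by rewrite ec in bx; apply/orP; left; apply/s1.
have /andP[vr1 r1p] : edge v r1 && (r1 != p) by rewrite -memN mem_head.
have /andP[vr2 r2p] : edge v r2 && (r2 != p).
  by rewrite -memN !inE eqxx orbT.
have r12 : r1 != r2 by move: uN; rewrite inE andbT.
have [l1 adj1 s1] := okside _ vr1 r1p; have [l2 adj2 s2] := okside _ vr2 r2p.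
have l1v : layout k.+1 (rcons (fan k (narrow_order k) [:: v] r1) (v, k)).
  rewrite -cats1; apply: (@layout_glue _ _ _ _ _ [::]) => // x y /s1 bx /[1!inE] /eqP /= ->.
  split; first by apply/eqP => exv; apply: (@branchN v r1); rewrite -{2}exv.
  by case/(branch_out vr1 bx) => [/branchN|[-> _]].
rewrite -cat_rcons; split.
  (* Now [v] closes the earlier part. The branches of [r1] and [r2] are far from each other, so the
     edge from [v] to [r2] is the only crossing one. *)
  apply: layout_glue => // x y.
  rewrite /unzip1 map_rcons mem_rcons inE => + /s2 bY; case/predU1P=> [->|/s1 bx].
    split; first by apply/eqP => /= evy; apply: (@branchN v r2); rewrite {2}evy.
    rewrite edge_sym => yv.
    by have [/branchN|[-> _]] := branch_out vr2 bY yv.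
  by have [xy /negP nxy] := branch_far vr1 vr2 r12 bx bY.
move=> x; rewrite /unzip1 map_cat map_rcons mem_cat mem_rcons inE -orbA (branchP x pv).
split.
  case/or3P=> [/eqP|/s1 bx|/s2 bx]; first by left.
    by right; exists r1.
  by right; exists r2.
case=> [->|[c []]]; first by rewrite eqxx.
move=> vc cp bx; have := memN c; rewrite vc cp !inE /= => /orP[]/eqP ec;
  rewrite ec in bx; apply/or3P.
  by apply: Or32; apply/s1.
by apply: Or33; apply/s2.
Qed.


(** * Longest paths and the centre edge *)

Lemma size_simple_path x q : simple_path x q -> size q <= diameter T.
Proof.
move=> sq; have lt_q : size q < #|T|.
  have /andP[_ /card_uniqP sE] := sq.
  by rewrite -[_.+1]/(size (x :: q)) -sE max_card.
apply: (@leq_bigmax_cond _ _ (@nat_of_ord _) (Ordinal lt_q)).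
by apply/existsP; exists x; apply/existsP; exists (in_tuple q).
Qed.

Lemma diameter_attained :
  0 < #|T| -> exists x q, simple_path x q /\ size q = diameter T.
Proof.
move=> T_gt0; have [x _] := card_gt0P T_gt0.
pose A := [pred n : 'I_#|T| |
  [exists x : T, exists q : n.-tuple T, simple_path x q]].
have A_gt0 : 0 < #|A|.
  apply/card_gt0P; exists (Ordinal T_gt0); rewrite inE.
  by apply/existsP; exists x; apply/existsP; exists [tuple].
have [n /existsP[y /existsP[q yq]] dE] := eq_bigmax_cond (@nat_of_ord _) A_gt0.
by exists y, q; split=> //; rewrite size_tuple -dE.
Qed.

(** Reversing [q1], crossing [ab] and following [q2] gives a path, simple because the two branches
    are disjoint. *)
Lemma size_branches a b q1 q2 : edge a b ->
  path edge a q1 -> uniq [:: b, a & q1] -> path edge b q2 -> uniq [:: a, b & q2] ->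
  size q1 + size q2 < diameter T.
Proof.
move=> ab aq1 uq1 bq2 uq2.
have revE : last a q1 :: rev (belast a q1) = rev (a :: q1).
  by rewrite -rev_rcons -lastI.
suff /size_simple_path : simple_path (last a q1) (rev (belast a q1) ++ b :: q2).
  by rewrite size_cat size_rev size_belast /= addnS.
apply/andP; split.
  rewrite cat_path rev_path; have -> : last (last a q1) (rev (belast a q1)) = a.
    by case: (q1) => //= c r; rewrite rev_cons last_rcons.
  by rewrite /= ab bq2 !andbT (eq_path (e' := edge)) // => x y; rewrite edge_sym.
rewrite -cat_cons revE cat_uniq rev_uniq.
have /andP[_ ua] := uq1; have /andP[_ ub] := uq2; apply/and3P; split=> //.
apply/hasPn => y yq2; rewrite mem_rev; apply/negP => yq1.
exact: branch_disjoint_edge ab (mem_branch bq2 uq2 yq2) (mem_branch aq1 uq1 yq1).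
Qed.

(** In the middle of a longest path, a path too long on one side would exceed the diameter once
    joined to the opposite half. *)
Lemma center_edge : 0 < #|T| -> 0 < diameter T ->
  exists a b, [/\ edge a b, low a b (diameter T)./2.+1 & low b a (diameter T)./2.+1].
Proof.
move=> /diameter_attained[x [q [/andP[xq uq] dE]]].
rewrite -dE => q_gt0.
(* [q] omits the start [x], so [b], at index [m] of [q], is [m + 1] steps from [x], and [a] is [m]
   steps away. *)
pose m := (size q)./2.
have m_lt : m < size q by rewrite /m; lia.
move: xq uq; rewrite -{1 2}(cat_take_drop m q) (drop_nth x) //.
set q1 := take m q; set b := nth x q m; set q2 := drop m.+1 q.
have sq1 : size q1 = m by rewrite size_takel // ltnW.
have sq2 : size q2 = size q - m.+1 by rewrite size_drop.
set a := last x q1.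
rewrite cat_path /= -/a => /and3P[xq1 ab bq2] uq.
exists a, b; have revE : a :: rev (belast x q1) = rev (x :: q1).
  by rewrite -rev_rcons -lastI.
have uq12 : uniq ((x :: q1) ++ b :: q2) by [].
have uq1 : uniq [:: b, a & rev (belast x q1)].
  rewrite revE cons_uniq mem_rev rev_uniq.
  move: uq12; rewrite cat_uniq => /and3P[-> /hasPn-> //].
  by rewrite mem_head.
have uq2 : uniq [:: a, b & q2].
  move: uq12; rewrite lastI cat_rcons cat_uniq.
  by case/and3P.
have aq1 : path edge a (rev (belast x q1)).
  by rewrite rev_path (eq_path (e' := edge)) // => y z; rewrite edge_sym.
split=> // r pr ur.
  have := size_branches ab aq1 uq1 pr ur.
  by rewrite size_rev size_belast sq1 -dE /m; lia.
have := size_branches ab pr ur bq2 uq2.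
by rewrite sq2 -dE /m; lia.
Qed.

End Tree.

(** * From the centre edge to the two bounds *)

Lemma thinness_low (T : sgraph) (k h : nat) (F : T -> T -> seq (T * nat)) :
  is_tree T -> (diameter T)./2 < h.+2 ->
  (forall p v : T, edge p v -> low p v h -> layout k (F p v) /\ spans p v (F p v)) ->
  thinness T <= k.+1.
Proof.
case=> T_gt0 conT acT dh okF.
have [d0|d_gt0] := posnP (diameter T); last first.
  have [a [b [ab lab lba]]] := center_edge acT T_gt0 d_gt0.
  by apply: (thinness_double_fan acT conT ab _ _ okF); apply: low_leq dh _.
(* Diameter 0 gives no centre edge, but then the tree is a single vertex. *)
have [_ /(_ _ (k_thin_card T))] := thinnessP T.
move/leq_trans; apply; apply: leq_trans (_ : 1 <= _) => //.
apply/card_le1_eqP => x y _ _; have /connectP[q xq ->] := conT x y.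
have [q' xq' uq' _] := shortenP xq.
by have := @size_simple_path T x q'; rewrite /simple_path xq' uq' d0 => /(_ isT); case: (q').
Qed.

Local Open Scope ring_scope.

Theorem theorem21 (T : sgraph) (d : nat) (hT : is_tree T) (hd : d = diameter T) :
  (thinness T)%:Z <= Num.ceil ((d%:R + 1) / 4 : rat) /\
  ((max_degree T <= 3)%N ->
   (thinness T)%:Z <= Num.ceil ((d%:R + 3) / 6 : rat)).
Proof.
have acT : acyclic T by case: hT.
have ceil_bound (n k : nat) (x : rat) : (n <= k.+1)%N -> k%:R < x -> n%:Z <= Num.ceil x.
  move=> nk kx; apply: le_trans (_ : k.+1%:Z <= _); first by rewrite lez_nat.
  by rewrite -addn1 PoszD lezD1 ceil_gt_int.
split=> [|deg3].
  (* [d %/ 4] is one less than the ceiling of [(d + 1) / 4]; the centre edge accounts for the extra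
     class. The height condition amounts to [d < 4 * (d %/ 4) + 4]. *)
  apply: (ceil_bound _ (d %/ 4)%N).
    apply: (@thinness_low _ _ (d %/ 4).*2 (wide_order (d %/ 4))) => //.
      by rewrite -hd; lia.
    by move=> p v; apply: wide_orderP.
  by rewrite ltr_pdivlMr // -natrM natr1 ltr_nat; lia.
(* Likewise [(d + 2) %/ 6] is one less than the ceiling of [(d + 3) / 6]. The shift by 2 reflects
   that the centre edge removes only two levels, while later steps remove three. *)
apply: (ceil_bound _ ((d + 2) %/ 6)%N).
  apply: (@thinness_low _ _ (3 * ((d + 2) %/ 6)) (narrow_order ((d + 2) %/ 6))) => //.
    by rewrite -hd; lia.
  by move=> p v; apply: narrow_orderP.
by rewrite ltr_pdivlMr // -natrM -natrD ltr_nat; lia.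
Qed.
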